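(* Let $M$ be a finite dimensional $\tilde H$-module. Let $t\in T$ and let $J\subseteq P(t)$. Then $$\dim(M_{wt}^{\rm gen})=\dim(M_{w't}^{\rm gen})\qquad\text{for all }w,w'\in\mathcal F^{(t,J)}.$$
   Context: Let $R$ be a reduced crystallographic root system spanning a real vector space $\mathfrak h_{\mathbb R}^*\cong\mathbb R^n$ with Weyl group $W$ and $W$-invariant inner product $\langle\,,\rangle$, positive roots $R^+$, negative roots $R^-=-R^+$, simple roots $\alpha_1,\dots,\alpha_n$, and simple reflections $s_1,\dots,s_n$. Let $\alpha_i^\vee=2\alpha_i/\langle\alpha_i,\alpha_i\rangle$, let $\omega_1,\dots,\omega_n$ be the fundamental weights, $\langle\omega_i,\alpha_j^\vee\rangle=\delta_{ij}$, and let $P=\sum_i\mathbb Z\omega_i$ be the weight lattice. Let $X=\{X^\lambda\mid\lambda\in P\}$ be the group with $X^\lambda X^\mu=X^{\lambda+\mu}$, with $W$-action $wX^\lambda=X^{w\lambda}$. Fix $q\in\mathbb C^*$ with $q^2\ne\pm1$. The affine Hecke algebra $\tilde H$ is the $\mathbb C$-algebra generated by $T_1,\dots,T_n$ and $X^\lambda$ ($\lambda\in P$), with relations: $T_i^2=(q-q^{-1})T_i+1$; the braid relations $T_iT_jT_i\cdots=T_jT_iT_j\cdots$ ($m_{ij}$ factors on each side, $m_{ij}$ the order of $s_is_j$ in $W$) for $i\neq j$; $X^\lambda X^\mu=X^{\lambda+\mu}$; and $$X^\lambda T_i=T_iX^{s_i\lambda}+(q-q^{-1})\frac{X^\lambda-X^{s_i\lambda}}{1-X^{-\alpha_i}}.$$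 Let $T=\mathrm{Hom}(X,\mathbb C^* )$ be the set of group homomorphisms $X\to\mathbb C^*$, with $W$-action $(wt)(X^\lambda)=t(X^{w^{-1}\lambda})$. For a finite dimensional $\tilde H$-module $M$ and $t\in T$, $$M_t^{\rm gen}=\{m\in M\mid\text{for each }X^\lambda\in X,\ (X^\lambda-t(X^\lambda))^km=0\text{ for some }k\in\mathbb Z_{>0}\}.$$ For $w\in W$ the inversion set is $R(w)=\{\alpha\in R^+\mid w\alpha\in R^-\}$. For $t\in T$, $$Z(t)=\{\alpha\in R^+\mid t(X^\alpha)=1\},\qquad P(t)=\{\alpha\in R^+\mid t(X^\alpha)=q^{2}\text{ or }t(X^\alpha)=q^{-2}\},$$ and for $J\subseteq P(t)$, $$\mathcal F^{(t,J)}=\{w\in W\mid R(w)\cap Z(t)=\emptyset,\ R(w)\cap P(t)=J\}.$$ *)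

(* Defs.v *)
From HB Require Import structures.
From mathcomp Require Import all_boot all_order all_algebra.
From mathcomp Require Import boolp classical_sets reals.
From mathcomp Require Import complex.

Set Implicit Arguments.
Unset Strict Implicit.
Unset Printing Implicit Defensive.

Import Order.TTheory GRing.Theory Num.Theory.

Local Open Scope classical_set_scope.
Local Open Scope ring_scope.

Inductive aterm (K G : Type) : Type :=
| AGen of G
| AConst of K
| AAdd of aterm K G & aterm K G
| AMul of aterm K G & aterm K G.
Arguments AGen {K G}.
Arguments AConst {K G}.
Arguments AAdd {K G}.
Arguments AMul {K G}.

HB.instance Definition _ (K G : Type) := gen_eqMixin (aterm K G).
HB.instance Definition _ (K G : Type) := gen_choiceMixin (aterm K G).

Section PresentedAlgebra.
Variables (K : comNzRingType) (G : Type).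
Local Notation term := (aterm K G).
Variable rel : term -> term -> Prop.

(* The least congruence that contains [rel] and for which terms form a unital
   associative K-algebra; the scalar c acts as multiplication by [AConst c]. *)
Inductive acong : term -> term -> Prop :=
| acong_refl x : acong x x
| acong_sym x y : acong x y -> acong y x
| acong_trans y x z : acong x y -> acong y z -> acong x z
| acong_add x x' y y' :
    acong x x' -> acong y y' -> acong (AAdd x y) (AAdd x' y')
| acong_mul x x' y y' :
    acong x x' -> acong y y' -> acong (AMul x y) (AMul x' y')
| acong_addA x y z : acong (AAdd x (AAdd y z)) (AAdd (AAdd x y) z)
| acong_addC x y : acong (AAdd x y) (AAdd y x)
| acong_add0 x : acong (AAdd (AConst 0) x) x
| acong_addN x : acong (AAdd (AMul (AConst (-1)) x) x) (AConst 0)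
| acong_mulA x y z : acong (AMul x (AMul y z)) (AMul (AMul x y) z)
| acong_mul1 x : acong (AMul (AConst 1) x) x
| acong_mulDl x y z :
    acong (AMul (AAdd x y) z) (AAdd (AMul x z) (AMul y z))
| acong_mulDr x y z :
    acong (AMul x (AAdd y z)) (AAdd (AMul x y) (AMul x z))
| acong_constD a b : acong (AConst (a + b)) (AAdd (AConst a) (AConst b))
| acong_constM a b : acong (AConst (a * b)) (AMul (AConst a) (AConst b))
| acong_central a x : acong (AMul (AConst a) x) (AMul x (AConst a))
| acong_rel x y : rel x y -> acong x y.

Definition acongb (x y : term) : bool := `[< acong x y >].

Fact acongb_refl : reflexive acongb.
Proof. by move=> x; apply/asboolP; exact: acong_refl. Qed.
Fact acongb_sym : symmetric acongb.
Proof. by move=> x y; apply/asboolP/asboolP => /acong_sym. Qed.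
Fact acongb_trans : transitive acongb.
Proof.
by move=> y x z /asboolP xy /asboolP yz; apply/asboolP; exact: acong_trans xy yz.
Qed.

Canonical acong_equiv := EquivRel acongb acongb_refl acongb_sym acongb_trans.

Definition presented : Type := {eq_quot acongb}%qT.
HB.instance Definition _ : EqQuotient _ acongb presented :=
  EqQuotient.on presented.
HB.instance Definition _ := Choice.on presented.

Definition acls (x : term) : presented := (\pi_presented x)%qT.

Lemma aclsP x y : acls x = acls y <-> acong x y.
Proof.
by split => [/eqP|?]; [rewrite /acls eqmodE => /asboolP
                      | apply/eqP; rewrite /acls eqmodE; apply/asboolP].
Qed.

Lemma aclsK (h : presented) : acls (repr h) = h.
Proof. exact: reprK. Qed.

Lemma acls_ind (P : presented -> Prop) : (forall x, P (acls x)) -> forall h, P h.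
Proof. by move=> Px h; rewrite -(aclsK h). Qed.

Lemma repr_acls x : acong (repr (acls x)) x.
Proof. by apply/aclsP; rewrite aclsK. Qed.

Definition presented_add (g h : presented) := acls (AAdd (repr g) (repr h)).
Definition presented_mul (g h : presented) := acls (AMul (repr g) (repr h)).
Definition presented_opp (g : presented) := acls (AMul (AConst (-1)) (repr g)).
Definition presented_scale (c : K) (g : presented) :=
  acls (AMul (AConst c) (repr g)).

Lemma acls_add x y : acls (AAdd x y) = presented_add (acls x) (acls y).
Proof. by apply/aclsP; apply: acong_add; apply: acong_sym; exact: repr_acls. Qed.
Lemma acls_mul x y : acls (AMul x y) = presented_mul (acls x) (acls y).
Proof. by apply/aclsP; apply: acong_mul; apply: acong_sym; exact: repr_acls. Qed.
Lemma acls_opp x : acls (AMul (AConst (-1)) x) = presented_opp (acls x).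
Proof.
apply/aclsP; apply: acong_mul; first exact: acong_refl.
by apply: acong_sym; exact: repr_acls.
Qed.
Lemma acls_scale c x : acls (AMul (AConst c) x) = presented_scale c (acls x).
Proof.
apply/aclsP; apply: acong_mul; first exact: acong_refl.
by apply: acong_sym; exact: repr_acls.
Qed.

Fact presented_addA : associative presented_add.
Proof.
elim/acls_ind=> x; elim/acls_ind=> y; elim/acls_ind=> z.
by rewrite -!acls_add; apply/aclsP; exact: acong_addA.
Qed.
Fact presented_addC : commutative presented_add.
Proof.
elim/acls_ind=> x; elim/acls_ind=> y.
by rewrite -!acls_add; apply/aclsP; exact: acong_addC.
Qed.
Fact presented_add0 : left_id (acls (AConst 0)) presented_add.
Proof. by elim/acls_ind=> x; rewrite -acls_add; apply/aclsP/acong_add0. Qed.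
Fact presented_addN :
  left_inverse (acls (AConst 0)) presented_opp presented_add.
Proof.
by elim/acls_ind=> x; rewrite -acls_opp -acls_add; apply/aclsP/acong_addN.
Qed.
HB.instance Definition _ := GRing.isZmodule.Build presented
  presented_addA presented_addC presented_add0 presented_addN.

Lemma aclsD x y : acls (AAdd x y) = acls x + acls y.
Proof. exact: acls_add. Qed.
Lemma aclsN x : acls (AMul (AConst (-1)) x) = - acls x.
Proof. exact: acls_opp. Qed.

Fact presented_mulA : associative presented_mul.
Proof.
elim/acls_ind=> x; elim/acls_ind=> y; elim/acls_ind=> z.
by rewrite -!acls_mul; apply/aclsP; exact: acong_mulA.
Qed.
Fact presented_mul1 : left_id (acls (AConst 1)) presented_mul.
Proof. by elim/acls_ind=> x; rewrite -acls_mul; apply/aclsP/acong_mul1. Qed.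
Fact presented_1mul : right_id (acls (AConst 1)) presented_mul.
Proof.
elim/acls_ind=> x; rewrite -acls_mul; apply/aclsP.
exact: acong_trans (acong_sym (acong_central _ _)) (acong_mul1 _).
Qed.
Fact presented_mulDl : left_distributive presented_mul +%R.
Proof.
elim/acls_ind=> x; elim/acls_ind=> y; elim/acls_ind=> z.
by rewrite -[acls x + acls y]aclsD -!acls_mul -aclsD; apply/aclsP; exact: acong_mulDl.
Qed.
Fact presented_mulDr : right_distributive presented_mul +%R.
Proof.
elim/acls_ind=> x; elim/acls_ind=> y; elim/acls_ind=> z.
by rewrite -[acls y + acls z]aclsD -!acls_mul -aclsD; apply/aclsP; exact: acong_mulDr.
Qed.
HB.instance Definition _ := GRing.Zmodule_isPzRing.Build presented
  presented_mulA presented_mul1 presented_1mul presented_mulDl presented_mulDr.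

Lemma aclsM x y : acls (AMul x y) = acls x * acls y.
Proof. exact: acls_mul. Qed.

Fact presented_scaleA a b h :
  presented_scale a (presented_scale b h) = presented_scale (a * b) h.
Proof.
elim/acls_ind: h => x; rewrite -!acls_scale; apply/aclsP.
apply: acong_trans (acong_mulA _ _ _) _.
apply: acong_mul; last exact: acong_refl.
by apply: acong_sym; exact: acong_constM.
Qed.
Fact presented_scale1 : left_id 1 presented_scale.
Proof. by elim/acls_ind=> x; rewrite -acls_scale; apply/aclsP/acong_mul1. Qed.
Fact presented_scaleDr : right_distributive presented_scale +%R.
Proof.
move=> a; elim/acls_ind=> x; elim/acls_ind=> y.
by rewrite -[acls x + acls y]aclsD -!acls_scale -aclsD; apply/aclsP/acong_mulDr.
Qed.
Fact presented_scaleDl h : {morph presented_scale^~ h : a b / a + b}.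
Proof.
elim/acls_ind: h => x a b; rewrite -!acls_scale -aclsD; apply/aclsP.
apply: acong_trans (acong_mulDl _ _ _); apply: acong_mul;
  [exact: acong_constD | exact: acong_refl].
Qed.
HB.instance Definition _ := GRing.Zmodule_isLmodule.Build K presented
  presented_scaleA presented_scale1 presented_scaleDr presented_scaleDl.

Lemma aclsZ c x : acls (AMul (AConst c) x) = c *: acls x.
Proof. exact: acls_scale. Qed.

Lemma presented_scaleAl (a : K) (g h : presented) : a *: (g * h) = (a *: g) * h.
Proof.
elim/acls_ind: g => x; elim/acls_ind: h => y.
rewrite -aclsM -!aclsZ -aclsM.
by apply/aclsP/acong_mulA.
Qed.

Lemma presented_scaleAr (a : K) (g h : presented) : a *: (g * h) = g * (a *: h).
Proof.
elim/acls_ind: g => x; elim/acls_ind: h => y.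
rewrite -aclsM -!aclsZ -aclsM; apply/aclsP.
apply: acong_trans (acong_mulA _ _ _) _.
apply: acong_trans (acong_sym (acong_mulA _ _ _)).
by apply: acong_mul; [exact: acong_central | exact: acong_refl].
Qed.

End PresentedAlgebra.

Section Reflections.
Variables (R : realType) (V : vectType R) (form : V -> V -> R).

Definition is_inner_product : Prop :=
  [/\ forall z, scalar (form^~ z),
      forall x y, form x y = form y x &
      forall x, x != 0 -> 0 < form x x].

Definition coroot (a : V) : V := (2 / form a a) *: a.

Definition reflect_fun (a x : V) : V := x - form x (coroot a) *: a.

Definition reflection (a : V) : 'End(V) := linfun (reflect_fun a).

End Reflections.

(* A reduced crystallographic root system spanning V, an inner product for
   which its reflections are orthogonal (hence invariant under the Weyl group),
   a choice of simple roots, and the fundamental weights. *)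
Record rootDatum (R : realType) (V : vectType R) (n : nat) := RootDatum {
  form : V -> V -> R;
  form_inner : is_inner_product form;
  roots : seq V;
  roots_neq0 : 0 \notin roots;
  roots_span : <<roots>>%VS = fullv;
  roots_stable : forall a b, a \in roots -> b \in roots ->
    reflect_fun form a b \in roots;
  roots_crystallographic : forall a b, a \in roots -> b \in roots ->
    exists m : int, form b (coroot form a) = m%:~R;
  roots_reduced : forall (a : V) (c : R),
    a \in roots -> c *: a \in roots -> c = 1 \/ c = -1;
  simple : n.-tuple V;
  simple_basis : basis_of fullv simple;
  simple_root : forall i, tnth simple i \in roots;
  simple_sign : forall b, b \in roots ->
    exists c : 'I_n -> nat,
      b = \sum_i tnth simple i *+ c i \/ b = - \sum_i tnth simple i *+ c i;
  fundamental : 'I_n -> V;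
  fundamentalP : forall i j,
    form (fundamental i) (coroot form (tnth simple j)) = (i == j)%:R
}.

Section RootDatum.
Variables (R : realType) (V : vectType R) (n : nat) (D : rootDatum V n).
Local Notation "<< x , y >>" := (form D x y).
Local Notation "a ^v" := (coroot (form D) a) (at level 2, format "a ^v").
Local Notation al i := (tnth (simple D) i).
Local Notation s_ a := (reflection (form D) a).

Definition positive_root (b : V) : Prop :=
  b \in roots D /\ exists c : 'I_n -> nat, b = \sum_i al i *+ c i.

Inductive in_weyl : 'End(V) -> Prop :=
| in_weyl1 : in_weyl \1%VF
| in_weylM a w : a \in roots D -> in_weyl w -> in_weyl (s_ a \o w)%VF.

Definition weight_lattice : {pred V} :=
  fun x => `[< exists c : 'I_n -> int, x = \sum_i fundamental D i *~ c i >].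

Lemma formDl z x y : << x + y, z >> = << x, z >> + << y, z >>.
Proof.
by have [L _ _] := form_inner D; have := L z 1 x y; rewrite scale1r mul1r.
Qed.
Lemma form0l z : << 0, z >> = 0.
Proof. by apply: (addrI << 0, z >>); rewrite -formDl !addr0. Qed.
Lemma formZl z a x : << a *: x, z >> = a * << x, z >>.
Proof.
have [L _ _] := form_inner D; have := L z a x 0.
by rewrite addr0 form0l addr0.
Qed.
Lemma formNl z x : << - x, z >> = - << x, z >>.
Proof. by rewrite -scaleN1r formZl mulN1r. Qed.
Lemma formBl z x y : << x - y, z >> = << x, z >> - << y, z >>.
Proof. by rewrite formDl formNl. Qed.
Lemma formMnl z x m : << x *+ m, z >> = << x, z >> *+ m.
Proof. by rewrite -scaler_nat formZl mulr_natl. Qed.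
Lemma formMzl z x (m : int) : << x *~ m, z >> = << x, z >> *~ m.
Proof. by rewrite -scaler_int formZl mulrzl. Qed.
Lemma form_suml z I (r : seq I) (F : I -> V) :
  << \sum_(i <- r) F i, z >> = \sum_(i <- r) << F i, z >>.
Proof.
by elim: r => [|i r IH]; rewrite ?big_nil ?form0l // !big_cons formDl IH.
Qed.
Lemma formC x y : << x, y >> = << y, x >>.
Proof. by have [_ H _] := form_inner D. Qed.
Lemma form_gt0 x : x != 0 -> 0 < << x, x >>.
Proof. by have [_ _] := form_inner D; apply. Qed.
Lemma formZr z a x : << z, a *: x >> = a * << z, x >>.
Proof. by rewrite !(formC z) formZl. Qed.

Lemma root_neq0 a : a \in roots D -> a != 0.
Proof. by apply: contraTneq => ->; exact: roots_neq0. Qed.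

Fact reflect_fun_linear a : linear (reflect_fun (form D) a).
Proof.
move=> c x y; rewrite /reflect_fun formDl formZl scalerBr scalerDl -scalerA.
by rewrite opprD addrACA.
Qed.

Lemma reflectionE a x : s_ a x = x - << x, a^v >> *: a.
Proof.
pose f : {linear V -> V} :=
  HB.pack (reflect_fun (form D) a)
    (GRing.isLinear.Build _ _ _ _ _ (reflect_fun_linear a)).
by rewrite /reflection -[reflect_fun _ _]/(f : V -> V) lfunE.
Qed.

Lemma form_coroot a : a \in roots D -> << a, a^v >> = 2.
Proof.
move=> /root_neq0/form_gt0 a0.
by rewrite /coroot formZr divfK // gt_eqF.
Qed.

Lemma reflectionK a : a \in roots D -> (s_ a \o s_ a)%VF = \1%VF.
Proof.
move=> Ra; apply/lfunP=> x; rewrite comp_lfunE id_lfunE !reflectionE.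
rewrite formBl formZl form_coroot // mulr_natr mulr2n opprD addrA subrr add0r.
by rewrite scaleNr opprK subrK.
Qed.

Lemma reflection_form a x y : a \in roots D ->
  << s_ a x, y >> = << x, s_ a y >>.
Proof.
move=> Ra; rewrite [RHS]formC !reflectionE /coroot !formBl !formZl !formZr.
by rewrite (formC y x) (formC a y) (formC a x) mulrAC.
Qed.

Lemma reflection_iso a x y : a \in roots D ->
  << s_ a x, s_ a y >> = << x, y >>.
Proof.
move=> Ra; rewrite reflection_form //.
by rewrite -comp_lfunE reflectionK // id_lfunE.
Qed.

Lemma in_weyl_root w b : in_weyl w -> b \in roots D -> w b \in roots D.
Proof.
move=> + Rb; elim=> [|a w' Ra _ IH]; first by rewrite id_lfunE.
by rewrite comp_lfunE reflectionE; exact: roots_stable.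
Qed.

Lemma in_weylMr w a : in_weyl w -> a \in roots D -> in_weyl (w \o s_ a)%VF.
Proof.
move=> + Ra; elim=> [|b w' Rb _ IH].
  by rewrite comp_lfun1l -[s_ a]comp_lfun1r; apply: in_weylM => //; constructor.
by rewrite -comp_lfunA; constructor.
Qed.

Lemma in_weyl_inverse w : in_weyl w ->
  exists2 w', in_weyl w' & (w' \o w = \1)%VF /\ (w \o w' = \1)%VF.
Proof.
elim=> [|a w' Ra _ [u Wu [uw wu]]].
  by exists \1%VF; [constructor | rewrite comp_lfun1l].
exists (u \o s_ a)%VF; first exact: in_weylMr.
split.
  by rewrite comp_lfunA -(comp_lfunA u) reflectionK // comp_lfun1r.
by rewrite comp_lfunA -(comp_lfunA _ w') wu comp_lfun1r reflectionK.
Qed.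

Lemma in_weyl_inv w : in_weyl w -> in_weyl (w^-1)%VF.
Proof.
move=> /in_weyl_inverse[u Wu [uw wu]]; suff -> : (w^-1)%VF = u by [].
have kw : lker w == 0%VS.
  apply/lker0P => x y xy.
  by rewrite -[x](id_lfunE x) -[y](id_lfunE y) -uw !comp_lfunE xy.
by rewrite -[u]comp_lfun1l -(lker0_compVf kw) -comp_lfunA wu comp_lfun1r.
Qed.

Lemma mem_basis_sum (x : V) : exists c : 'I_n -> R, x = \sum_i c i *: al i.
Proof.
exists (fun i => coord (simple D) i x).
have := coord_basis (simple_basis D) (memvf x) => {1}->.
by apply: eq_bigr => i _; rewrite -tnth_nth.
Qed.

Lemma form_simple_inj x : (forall i, << x, (al i)^v >> = 0) -> x = 0.
Proof.
move=> H; apply/eqP/negPn/negP => x0.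
have: << x, x >> = 0.
  have [c xE] := mem_basis_sum x.
  rewrite {1}xE form_suml big1 // => i _; rewrite formZl formC.
  have ai0 := form_gt0 (root_neq0 (simple_root D i)).
  have /eqP := H i; rewrite /coroot formZr mulf_eq0 => /orP[|/eqP->].
    by rewrite mulf_eq0 invr_eq0 pnatr_eq0 (gt_eqF ai0).
  by rewrite mulr0.
by have := form_gt0 x0; move=> /[swap] ->; rewrite ltxx.
Qed.

Lemma form_fundamental (c : 'I_n -> int) j :
  << \sum_i fundamental D i *~ c i, (al j)^v >> = (c j)%:~R.
Proof.
rewrite form_suml (bigD1 j) //= big1 => [|i ij].
  by rewrite formMzl fundamentalP eqxx addr0.
by rewrite formMzl fundamentalP (negPf ij) mul0rz.
Qed.

Lemma weight_latticeP x :
  reflect (forall i, exists m : int, << x, (al i)^v >> = m%:~R)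
          (x \in weight_lattice).
Proof.
apply: (iffP idP) => [/asboolP[c ->] i|/choice[c cE]].
  by exists (c i); rewrite form_fundamental.
apply/asboolP; exists c; apply/eqP; rewrite -subr_eq0; apply/eqP.
by apply: form_simple_inj => i; rewrite formBl form_fundamental cE subrr.
Qed.

Fact weight_lattice_zmod_closed : zmod_closed weight_lattice.
Proof.
split; first by apply/weight_latticeP => i; exists 0; rewrite form0l.
move=> x y /weight_latticeP Px /weight_latticeP Py; apply/weight_latticeP => i.
have [a xa] := Px i; have [b yb] := Py i.
by exists (a - b); rewrite formBl xa yb rmorphB.
Qed.
HB.instance Definition _ := GRing.isZmodClosed.Build V weight_lattice
  weight_lattice_zmod_closed.

Lemma root_in_weight_lattice b : b \in roots D -> b \in weight_lattice.
Proof.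
move=> Rb; apply/weight_latticeP => i.
exact: roots_crystallographic (simple_root D i) Rb.
Qed.

Lemma simple_coef_inj (c d : 'I_n -> R) :
  \sum_i c i *: al i = \sum_i d i *: al i -> c =1 d.
Proof.
have sE (e : 'I_n -> R) j : coord (simple D) j (\sum_i e i *: al i) = e j.
  under eq_bigr do rewrite (tnth_nth 0).
  by rewrite coord_sum_free // (basis_free (simple_basis D)).
by move=> E j; rewrite -(sE c) E sE.
Qed.

Definition integral_coroot b :=
  forall x, x \in weight_lattice -> exists m : int, << x, b^v >> = m%:~R.

Lemma reflection_weight b x : b \in roots D -> integral_coroot b ->
  x \in weight_lattice -> s_ b x \in weight_lattice.
Proof.
move=> Rb Ib Px; rewrite reflectionE rpredB //.
have [m ->] := Ib x Px; rewrite scaler_int rpredMz //.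
exact: root_in_weight_lattice.
Qed.

Lemma coroot_reflection a b : a \in roots D -> (s_ a b)^v = s_ a b^v.
Proof. by move=> Ra; rewrite /coroot reflection_iso // linearZ. Qed.

Lemma simple_integral i : integral_coroot (al i).
Proof. by move=> x /weight_latticeP/(_ i). Qed.

Lemma integral_reflection i b : integral_coroot b ->
  integral_coroot (s_ (al i) b).
Proof.
move=> Ib x Px; have Ri := simple_root D i.
rewrite coroot_reflection // -reflection_form //.
apply: Ib; apply: reflection_weight => //; exact: simple_integral.
Qed.

(* Induction on height: a positive root that is not simple is moved by some
   simple reflection to a positive root of smaller height. *)
Lemma positive_root_integral b : positive_root b -> integral_coroot b.
Proof.
move=> [Rb [c]].
have [N] := ubnP (\sum_i c i)%N; elim: N b c Rb => // N IH b c Rb ltN bE.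
have bb := form_gt0 (root_neq0 Rb).
have [i ci bi] : exists2 i, (0 < c i)%N & 0 < << b, al i >>.
  apply: contrapT => H; move: bb; apply/negP; rewrite -leNgt {1}bE form_suml.
  apply: sumr_le0 => i _; rewrite formMnl formC.
  have [->|ci] := posnP (c i); first by rewrite mulr0n.
  rewrite mulrn_wle0 // leNgt; apply/negP => bi; apply: H; by exists i.
have Ri := simple_root D i.
have ai := form_gt0 (root_neq0 Ri).
have sbR : s_ (al i) b \in roots D by rewrite reflectionE; exact: roots_stable.
have [k kE] := roots_crystallographic Ri Rb.
have kgt0 : 0 < k.
  rewrite -(ltr0z R) -kE /coroot formZr mulr_gt0 // divr_gt0 //.
have sbE : s_ (al i) b = \sum_j ((c j)%:R - (k *+ (j == i))%:~R) *: al j.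
  rewrite reflectionE kE {1}bE.
  under [RHS]eq_bigr do rewrite scalerBl scaler_nat.
  rewrite sumrB; congr (_ - _); rewrite (bigD1 i) //= eqxx big1 ?addr0 //.
  by move=> j /negPf ->; rewrite mulr0n scale0r.
have sbK : s_ (al i) (s_ (al i) b) = b.
  by rewrite -comp_lfunE reflectionK // id_lfunE.
have [d [dE|dE]] := simple_sign sbR.
- rewrite -sbK; apply: integral_reflection.
  apply: (IH _ d) => //; rewrite -ltnS; apply: leq_trans ltN; rewrite ltnS.
  have {}dE : (fun j => (c j)%:R - (k *+ (j == i))%:~R : R) =1 (fun j => (d j)%:R).
    apply: simple_coef_inj; rewrite -sbE dE.
    by apply: eq_bigr => j _; rewrite scaler_nat.
  rewrite (bigD1 i) //= [leqRHS](bigD1 i) //= -addSn leq_add //.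
    have := dE i; rewrite eqxx mulr1n => /eqP; rewrite subr_eq => /eqP E.
    by rewrite -(ltr_nat R) E ltrDl ltr0z.
  apply: leq_sum => j /negPf ji; have := dE j; rewrite ji mulr0n subr0 => /eqP.
  by rewrite eqr_nat => /eqP ->.
- (* the coefficients off i are unchanged and nonnegative, so they vanish *)
  have {}dE : (fun j => (c j)%:R - (k *+ (j == i))%:~R : R) =1
              (fun j => - (d j)%:R).
    apply: simple_coef_inj; rewrite -sbE dE -sumrN.
    by apply: eq_bigr => j _; rewrite scaleNr scaler_nat.
  have cj j : j != i -> c j = 0%N.
    move=> /negPf ji; have := dE j; rewrite ji mulr0n subr0 => /eqP.
    rewrite -subr_eq0 opprK -natrD pnatr_eq0 addn_eq0 => /andP[/eqP -> _] //.
  have bci : b = (c i)%:R *: al i.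
    rewrite {1}bE (bigD1 i) //= big1 ?addr0 ?scaler_nat //.
    by move=> j ji; rewrite cj // mulr0n.
  have : (c i)%:R *: al i \in roots D by rewrite -bci.
  move=> /(roots_reduced Ri)[c1|/eqP].
    by rewrite bci c1 scale1r; exact: simple_integral.
  by rewrite -subr_eq0 opprK -(natrD _ _ 1) pnatr_eq0 addn1.
Qed.

Lemma root_integral b : b \in roots D -> integral_coroot b.
Proof.
move=> Rb; have [c [bE|bE]] := simple_sign Rb.
  by apply: positive_root_integral; split => //; exists c.
have RNb : - b \in roots D.
  have := roots_stable Rb Rb; rewrite /reflect_fun form_coroot //.
  by rewrite -[X in X - _]scale1r -scalerBl -[2]/(1 + 1) opprD addNKr scaleN1r.
have : integral_coroot (- b).
  by apply: positive_root_integral; split => //; exists c; rewrite bE opprK.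
move=> I x Px; have [m E] := I x Px; exists (- m).
have cN : (- b)^v = - b^v by rewrite /coroot formNl formC formNl opprK scalerN.
by rewrite rmorphN /= -E cN [<< x, - _ >>]formC formNl opprK formC.
Qed.

Lemma in_weyl_weight w x : in_weyl w ->
  x \in weight_lattice -> w x \in weight_lattice.
Proof.
move=> + Px; elim=> [|a w' Ra _ IH]; first by rewrite id_lfunE.
by rewrite comp_lfunE; apply: reflection_weight => //; exact: root_integral.
Qed.

Record weight := Weight { weight_val : V; weightP : weight_val \in weight_lattice }.

HB.instance Definition _ := [isSub for weight_val].
HB.instance Definition _ := [Choice of weight by <:].
HB.instance Definition _ := [SubChoice_isSubZmodule of weight by <:].

Record weyl := Weyl { weyl_val : 'End(V); weylP : in_weyl weyl_val }.

Definition weyl_act (w : weyl) (l : weight) : weight :=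
  Weight (in_weyl_weight (weylP w) (weightP l)).

Definition weyl_inv (w : weyl) : weyl := Weyl (in_weyl_inv (weylP w)).

Definition simple_weight (i : 'I_n) : weight :=
  Weight (root_in_weight_lattice (simple_root D i)).

Definition simple_reflection (i : 'I_n) : weyl :=
  Weyl (in_weylMr in_weyl1 (simple_root D i)).

Definition coxeter_order (i j : 'I_n) (m : nat) : Prop :=
  let f := (s_ (al i) \o s_ (al j))%VF in
  [/\ (0 < m)%N, iter m f =1 id &
      forall k, (0 < k < m)%N -> ~ (iter k f =1 id)].

(* By [root_in_weight_lattice] every root is a weight, so sets of roots are
   taken as sets of weights and characters of X can be evaluated on them. *)
Definition Rpos : set weight := [set a | positive_root (weight_val a)].
Definition Rneg : set weight := [set a | Rpos (- a)].

Definition inversions (w : weyl) : set weight :=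
  [set a | Rpos a /\ Rneg (weyl_act w a)].

End RootDatum.

Arguments weight {R V n}.
Arguments weyl {R V n}.

Section AffineHecke.
Variables (R : realType) (V : vectType R) (n : nat) (D : rootDatum V n).
Variable q : R[i].

Inductive hecke_gen : Type :=
| GenT of 'I_n
| GenX of weight D.

Local Notation term := (aterm R[i] hecke_gen).
Local Notation T_ i := (AGen (GenT i) : term).
Local Notation X_ l := (AGen (GenX l) : term).
Local Notation s_ i := (weyl_act (simple_reflection D i)).
Local Notation al i := (simple_weight D i).

Fixpoint braid_word (m : nat) (i j : 'I_n) : term :=
  if m is m'.+1 then AMul (T_ i) (braid_word m' j i) else AConst 1.

Definition sumX (s : seq (weight D)) : term :=
  foldr (fun l x => AAdd (X_ l) x) (AConst 0) s.

(* The quotient (X^l - X^{s_i l}) / (1 - X^{-alpha_i}) in the group algebra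
   of the weight lattice: with k = <l, alpha_i^v> (an integer), it is
   X^l + X^{l - alpha_i} + ... + X^{l - (k-1) alpha_i} when k >= 0, and the
   opposite of the same expression for s_i l when k < 0
   (see [demazure_quotientP]). *)
Definition alpha_string (i : 'I_n) (l : weight D) (k : nat) : term :=
  sumX [seq l - al i *+ j | j <- iota 0 k].

Definition demazure_quotient (i : 'I_n) (l : weight D) : term :=
  match Num.floor (form D (weight_val l)
                     (coroot (form D) (tnth (simple D) i))) with
  | Posz k => alpha_string i l k
  | Negz k => AMul (AConst (-1)) (alpha_string i (s_ i l) k.+1)
  end.

(* [hecke_X0] and [hecke_XD] together say that the X^l form a copy of the group
   X in the algebra; [hecke_XT] uses the fraction of [demazure_quotient]. *)
Inductive hecke_rel : term -> term -> Prop :=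
| hecke_quadratic i :
    hecke_rel (AMul (T_ i) (T_ i))
              (AAdd (AMul (AConst (q - q^-1)) (T_ i)) (AConst 1))
| hecke_braid i j m : i != j -> coxeter_order D i j m ->
    hecke_rel (braid_word m i j) (braid_word m j i)
| hecke_X0 : hecke_rel (X_ 0) (AConst 1)
| hecke_XD l m : hecke_rel (AMul (X_ l) (X_ m)) (X_ (l + m))
| hecke_XT i l :
    hecke_rel (AMul (X_ l) (T_ i))
              (AAdd (AMul (T_ i) (X_ (s_ i l)))
                    (AMul (AConst (q - q^-1)) (demazure_quotient i l))).

Definition hecke : Type := presented hecke_rel.
HB.instance Definition _ := GRing.PzRing.on hecke.
HB.instance Definition _ := GRing.Lmodule.on hecke.

Definition heckeT (i : 'I_n) : hecke := acls hecke_rel (T_ i).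
Definition heckeX (l : weight D) : hecke := acls hecke_rel (X_ l).

Lemma heckeX0 : heckeX 0 = 1.
Proof. exact/aclsP/acong_rel/hecke_X0. Qed.

Lemma heckeXD l m : heckeX (l + m) = heckeX l * heckeX m.
Proof. by rewrite /heckeX -aclsM; apply/esym/aclsP/acong_rel/hecke_XD. Qed.

Lemma demazure_quotientP i l :
  (1 - heckeX (- al i)) * acls hecke_rel (demazure_quotient i l) =
  heckeX l - heckeX (s_ i l).
Proof.
have sumE s : acls hecke_rel (sumX s) = \sum_(m <- s) heckeX m.
  by elim: s => [|m s IH]; rewrite ?big_nil // big_cons -IH /= aclsD.
have telescope m k :
  (1 - heckeX (- al i)) * \sum_(j <- [seq m - al i *+ j | j <- iota 0 k]) heckeX j
    = heckeX m - heckeX (m - al i *+ k).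
  elim: k => [|k IH]; first by rewrite big_nil mulr0 mulr0n subr0 subrr.
  rewrite -addn1 iotaD map_cat big_cat /= mulrDr IH big_seq1 add0n.
  rewrite mulrBl mul1r -heckeXD addn1 mulrSr opprD addrA.
  by rewrite [- al i + _]addrC addrA subrK.
rewrite /demazure_quotient; set p := form _ _ _.
have [m pm] : exists m : int, p = m%:~R.
  exact: (weight_latticeP D _ (weightP l) i).
have sl : weight_val (s_ i l) = weight_val l - p *: tnth (simple D) i.
  by rewrite /= comp_lfun1l reflectionE.
have valMn (a : weight D) k : weight_val (a *+ k) = weight_val a *+ k.
  exact: (raddfMn (\val : weight D -> V)).
have valB (a b : weight D) : weight_val (a - b) = weight_val a - weight_val b.
  exact: (raddfB (\val : weight D -> V)).
rewrite pm intrKfloor; case: m pm => k pm; rewrite /alpha_string.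
  rewrite sumE telescope.
  congr (_ - heckeX _); apply: val_inj; rewrite [LHS]valB valMn.
  by rewrite [RHS]sl pm -pmulrn scaler_nat.
rewrite aclsN sumE mulrN telescope opprB; congr (heckeX _ - _).
apply: val_inj; rewrite [LHS]valB valMn [weight_val (s_ i l)]sl pm.
by rewrite NegzE rmorphN /= -pmulrn scaleNr scaler_nat opprK addrK.
Qed.

(* A finite dimensional module is a finite dimensional complex vector space
   with a unital algebra morphism to its endomorphisms; the product of
   endomorphisms is composition, so the action is a left action. *)

Record heckeModule (M : vectType R[i]) := HeckeModule {
  hact :> hecke -> 'End(M);
  hact_linear : linear hact;
  hact1 : hact 1 = \1%VF;
  hactM : forall g h, hact (g * h) = (hact g \o hact h)%VF
}.

(* Hom(X, C^* ): the group X is the weight lattice written multiplicatively,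
   [t l] stands for the value of t at X^l. *)
Record torus := Torus {
  torus_val :> weight D -> R[i];
  torus_neq0 : forall l, torus_val l != 0;
  torusD : forall l m, torus_val (l + m) = torus_val l * torus_val m
}.

Lemma weyl_actD (w : weyl D) (l m : weight D) :
  weyl_act w (l + m) = weyl_act w l + weyl_act w m.
Proof.
have valD (a b : weight D) : weight_val (a + b) = weight_val a + weight_val b.
  exact: (raddfD (\val : weight D -> V)).
by apply: val_inj; apply: etrans (esym (valD _ _)); apply: etrans (linearD _ _ _); congr (weyl_val w _); exact: valD.
Qed.

Definition torus_act (w : weyl D) (t : torus) : torus.
Proof.
exists (fun l => t (weyl_act (weyl_inv w) l)).
- by move=> l; exact: torus_neq0.
- by move=> l m; rewrite weyl_actD torusD.
Defined.

Definition Zset (t : torus) : set (weight D) :=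
  [set a | Rpos a /\ t a = 1].

Definition Pset (t : torus) : set (weight D) :=
  [set a | Rpos a /\ (t a = q ^+ 2 \/ t a = q ^- 2)].

Definition Fset (t : torus) (J : set (weight D)) : set (weyl D) :=
  [set w | inversions w `&` Zset t = set0 /\ inversions w `&` Pset t = J].

Section GeneralizedWeightSpace.
Variables (M : vectType R[i]) (rho : heckeModule M) (t : torus).

Definition gen_weight_vector (m : M) : Prop :=
  forall l : weight D, exists k : nat,
    (0 < k)%N /\ rho ((heckeX l - t l *: (1 : hecke)) ^+ k) m = 0.

Lemma gen_weight_vector0 : gen_weight_vector 0.
Proof. by move=> l; exists 1%N; rewrite linear0. Qed.

Lemma gen_weight_vectorP (a : R[i]) u v :
  gen_weight_vector u -> gen_weight_vector v -> gen_weight_vector (a *: u + v).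
Proof.
move=> Hu Hv l; have [j [j0 uj]] := Hu l; have [k [k0 vk]] := Hv l.
exists (j + k)%N; split; first by rewrite addn_gt0 j0.
rewrite linearP /=; rewrite {1}addnC !exprD !hactM !comp_lfunE uj vk.
by rewrite !linear0 addr0.
Qed.

Lemma gen_weight_spaceP :
  exists U : {vspace M}, forall m, m \in U <-> gen_weight_vector m.
Proof.
pose sub (U : {vspace M}) := forall m, m \in U -> gen_weight_vector m.
pose P d := `[< exists2 U, sub U & \dim U = d >].
have exP : exists d, P d.
  exists 0%N; apply/asboolP; exists 0%VS; last exact: dimv0.
  by move=> m; rewrite memv0 => /eqP ->; exact: gen_weight_vector0.
have bP d : P d -> (d <= \dim {:M})%N.
  by move=> /asboolP[U _ <-]; exact: dimvS (subvf U).
have [d /asboolP[U sU dU] maxd] := ex_maxnP exP bP.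
exists U => m; split; first exact: sU.
move=> gm; apply/negPn/negP => mU.
have /maxd : P (\dim (U + <[m]>)).
  apply/asboolP; exists (U + <[m]>)%VS => // x.
  move=> /memv_addP[u uU [v /vlineP[c ->] ->]].
  by rewrite addrC; apply: gen_weight_vectorP => //; exact: sU.
rewrite -dU leqNgt => /negP; apply.
rewrite ltn_neqAle dimvS ?addvSl // andbT.
apply: contra mU => /eqP E.
have : (U == U + <[m]>)%VS by rewrite eqEdim addvSl E leqnn.
by move=> /eqP ->; exact: (subvP (addvSr _ _) _ (memv_line m)).
Qed.

Definition gen_weight_space : {vspace M} := sval (cid gen_weight_spaceP).

Lemma mem_gen_weight_space m : m \in gen_weight_space <-> gen_weight_vector m.
Proof. exact: (svalP (cid gen_weight_spaceP)). Qed.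

End GeneralizedWeightSpace.

End AffineHecke.

(* Main.v *)
(* The element [phi_i = T_i (1 - X^(-alpha_i)) - (q - q^-1)] satisfies
   [X^l phi_i = phi_i X^(s_i l)], so it maps [M_t^gen] to [M_(s_i t)^gen], and
   [X^alpha_i phi_i^2 = - (X^alpha_i - q^2) (X^alpha_i - q^-2)], so it is
   injective there when [t(X^alpha_i)] is not [q^2] or [q^-2]; by symmetry the
   two spaces then have the same dimension.

   If [w, w'] lie in [F^(t,J)] and [w' w^-1] sends [alpha_i] to a negative root,
   then [w] and [w'] lie on different sides of the wall of the root
   [w^-1 alpha_i], which therefore belongs (up to sign) neither to [Z(t)] nor to
   [P(t)]: [s_i w] is again in [F^(t,J)], and the intertwiner applies to [w t].
   The last letter [i] of a word for [w' w^-1] either has this property, or the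
   deletion condition gives a shorter word for [w' w^-1]. *)

From Pilot Require Import Defs.
From mathcomp Require Import all_boot all_order all_algebra.
From mathcomp Require Import boolp classical_sets reals.
From mathcomp Require Import complex.
From mathcomp Require Import ring.
(* [all_algebra] shadows [roots] and [form]. *)
Import Pilot.Defs.

Import Order.TTheory GRing.Theory Num.Theory.

Local Open Scope classical_set_scope.
Local Open Scope ring_scope.

(** * Positive roots and simple reflections *)

Section Roots.
Set Implicit Arguments.
Unset Strict Implicit.
Variables (R : realType) (V : vectType R) (n : nat) (D : rootDatum V n).
Local Notation Phi := (roots D).
Local Notation al i := (tnth (simple D) i).
Local Notation refl a := (reflection (form D) a).
Implicit Types (a b : V) (i j : 'I_n) (s : seq 'I_n).

Lemma reflection_root a b :
  a \in Phi -> b \in Phi -> refl a b \in Phi.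
Proof. by move=> Ra Rb; rewrite reflectionE; exact: roots_stable. Qed.

Lemma reflectK a b : a \in Phi -> refl a (refl a b) = b.
Proof. by move=> Ra; rewrite -comp_lfunE reflectionK // id_lfunE. Qed.

Lemma reflection_self a : a \in Phi -> refl a a = - a.
Proof.
move=> Ra; rewrite reflectionE form_coroot // -[2]/(1 + 1) scalerDl scale1r.
by rewrite opprD addNKr.
Qed.

Lemma coord_simple j i : coord (simple D) j (al i) = (i == j)%:R.
Proof.
by rewrite (tnth_nth 0) coord_free ?(basis_free (simple_basis D)).
Qed.

Lemma coord_simple_sum j (c : 'I_n -> nat) :
  coord (simple D) j (\sum_i al i *+ c i) = (c j)%:R.
Proof.
rewrite linear_sum (bigD1 j) //= big1 => [|i /negPf ij].
  by rewrite linearMn /= coord_simple eqxx addr0.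
by rewrite linearMn /= coord_simple ij mul0rn.
Qed.

Lemma coord_reflection_simple i j b : j != i ->
  coord (simple D) j (refl (al i) b) = coord (simple D) j b.
Proof.
rewrite eq_sym => /negPf ij.
by rewrite reflectionE linearB linearZ /= coord_simple ij mulr0 subr0.
Qed.

Lemma coord_positive_root b j : positive_root D b -> 0 <= coord (simple D) j b.
Proof. by move=> [_ [c ->]]; rewrite coord_simple_sum ler0n. Qed.

Lemma root_sign b : b \in Phi -> positive_root D b \/ positive_root D (- b).
Proof.
move=> Rb; have RNb : - b \in Phi by rewrite -reflection_self // reflection_root.
have [c [bE|bE]] := simple_sign Rb; [left|right]; split=> //; exists c => //.
by rewrite bE opprK.
Qed.

Lemma positive_root_opp b : positive_root D b -> positive_root D (- b) -> False.
Proof.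
move=> pb pNb; have /eqP := root_neq0 pb.1; apply.
rewrite (coord_basis (simple_basis D) (memvf b)) big1 // => i _.
suff -> : coord (simple D) i b = 0 by rewrite scale0r.
apply/eqP; rewrite eq_le coord_positive_root // andbT -oppr_ge0 -linearN /=.
exact: coord_positive_root.
Qed.

Lemma simple_positive i : positive_root D (al i).
Proof.
split; first exact: simple_root.
exists (fun j => nat_of_bool (j == i)); rewrite (bigD1 i) //= eqxx mulr1n.
by rewrite big1 ?addr0 // => j /negPf ->.
Qed.

(** Reflecting in [al i] changes only the i-th coefficient. If the image were negative, all other
    coefficients of [b] would vanish, and reducedness would force [b = al i]. *)
Lemma simple_reflection_positive i b : positive_root D b -> b != al i ->
  positive_root D (refl (al i) b).
Proof.
move=> pb bi; have Ri := simple_root D i; have [Rb [c bE]] := pb.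
have [//|npos] := root_sign (reflection_root Ri Rb).
have b0 j : j != i -> c j = 0%N.
  move=> ji; apply/eqP; rewrite -(pnatr_eq0 R) -(coord_simple_sum j c) -bE.
  rewrite eq_le coord_positive_root // andbT -oppr_ge0.
  rewrite -(coord_reflection_simple _ ji) -linearN /=.
  exact: coord_positive_root.
have {}bE : b = (c i)%:R *: al i.
  rewrite {1}bE (bigD1 i) //= big1 ?addr0 ?scaler_nat // => j ji.
  by rewrite b0.
have : (c i)%:R *: al i \in Phi by rewrite -bE.
move=> /(roots_reduced Ri)[c1|/eqP].
  by rewrite bE c1 scale1r eqxx in bi.
by rewrite -subr_eq0 opprK -(natrD _ _ 1) pnatr_eq0 addn1.
Qed.

(** * Words in the simple reflections *)

Definition simple_word s : 'End(V) :=
  foldr (fun i f => (refl (al i) \o f)%VF) \1%VF s.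

Lemma simple_word_cat s s' :
  simple_word (s ++ s') = (simple_word s \o simple_word s')%VF.
Proof.
by elim: s => [|i s IH] /=; rewrite ?comp_lfun1l // IH comp_lfunA.
Qed.

Lemma simple_word_rcons s i :
  simple_word (rcons s i) = (simple_word s \o refl (al i))%VF.
Proof. by rewrite -cats1 simple_word_cat /= comp_lfun1r. Qed.

Lemma simple_word_root s b : b \in Phi -> simple_word s b \in Phi.
Proof.
move=> Rb; elim: s => [|i s IH] /=; first by rewrite id_lfunE.
by rewrite comp_lfunE reflection_root // simple_root.
Qed.

Lemma simple_word_form s (x y : V) :
  form D (simple_word s x) (simple_word s y) = form D x y.
Proof.
elim: s => [|i s IH] /=; first by rewrite !id_lfunE.
by rewrite !comp_lfunE reflection_iso // simple_root.
Qed.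

Lemma reflection_word_conj s a :
  (simple_word s \o refl a = refl (simple_word s a) \o simple_word s)%VF.
Proof.
apply/lfunP => x; rewrite !comp_lfunE !reflectionE linearB linearZ /=.
by rewrite /coroot !formZr !simple_word_form.
Qed.

Lemma positive_simple_pairing b : positive_root D b ->
  exists i, 0 < form D b (al i).
Proof.
move=> [Rb [c bE]]; apply: contrapT => H.
have := form_gt0 D (root_neq0 Rb); apply/negP; rewrite -leNgt {1}bE form_suml.
apply: sumr_le0 => i _; rewrite formMnl formC mulrn_wle0 // leNgt.
by apply/negP => bi; apply: H; exists i.
Qed.

(** Induction on height: if [b] is not simple and pairs positively with [al i], then [s_i b] is a
    positive root of smaller height, and the reflection in [b] is that in [s_i b] conjugated by
    [s_i]. *)
Lemma positive_reflection_word b : positive_root D b ->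
  exists s, refl b = simple_word s.
Proof.
move=> pb; have [c bE] := pb.2.
have [N] := ubnP (\sum_i c i)%N; elim: N b c pb bE => // N IH b c pb bE ltN.
have [i bi] := positive_simple_pairing pb.
have [->|bNi] := eqVneq b (al i); first by exists [:: i]; rewrite /= comp_lfun1r.
have Ri := simple_root D i; have Rb := pb.1.
have psb := simple_reflection_positive pb bNi; have [_ [d dE]] := psb.
have [s sE] : exists s, refl (refl (al i) b) = simple_word s.
  apply: (IH _ d) => //; rewrite -ltnS; apply: leq_trans ltN; rewrite ltnS.
  (* The i-th coefficient drops by the positive number [<b, alpha_i^v>]; the others stay. *)
  have di j : j != i -> d j = c j.
    move=> ji; apply/eqP; rewrite -(eqr_nat R) -!coord_simple_sum -dE -bE.
    by rewrite coord_reflection_simple.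
  rewrite (bigD1 i) //= [ltnRHS](bigD1 i) //= (eq_bigr _ di) ltn_add2r.
  rewrite -(ltr_nat R) -!coord_simple_sum -dE -bE reflectionE linearB linearZ /=.
  rewrite coord_simple eqxx mulr1 ltrBlDr ltrDl /coroot formZr mulr_gt0 //.
  by rewrite divr_gt0 // form_gt0 // (root_neq0 Ri).
exists (i :: rcons s i); rewrite /= simple_word_rcons -sE.
have := reflection_word_conj [:: i] b; rewrite /= !comp_lfun1r => <-.
by rewrite comp_lfunA reflectionK // comp_lfun1l.
Qed.

Lemma reflection_opp b : b \in Phi -> refl (- b) = refl b.
Proof.
move=> Rb; apply/lfunP => x; rewrite !reflectionE /coroot !formZr formNl.
rewrite !(formC _ _ (- b)) !formNl opprK scalerN mulrN scaleNr opprK.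
by rewrite (formC _ x b).
Qed.

(** [in_weyl] is generated by the reflections in all roots; this passes to the simple ones. *)
Lemma weyl_word (u : 'End(V)) : in_weyl D u -> exists s, u = simple_word s.
Proof.
elim=> [|a w Ra _ [s ->]]; first by exists [::].
have [s' E] : exists s', refl a = simple_word s'.
  have [pa|pa] := root_sign Ra; first exact: positive_reflection_word.
  by rewrite -reflection_opp //; exact: positive_reflection_word.
by exists (s' ++ s); rewrite simple_word_cat E.
Qed.

(** Apply the letters of [s] to [al j] from right to left. The letter [i] at which the root first
    turns negative meets it as [al i], the only positive root that [s_i] makes negative; by
    conjugation this letter cancels against the final [s_j]. *)
Lemma simple_word_deletion s j : positive_root D (- simple_word s (al j)) ->
  exists2 s', (size s' < size s)%N &
    (simple_word s \o refl (al j))%VF = simple_word s'.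
Proof.
elim: s => [|i s IH] /=.
  by rewrite id_lfunE => /(positive_root_opp (simple_positive j)).
rewrite comp_lfunE -linearN => neg.
have Rj := simple_root D j; have Ri := simple_root D i.
have [pb|/IH[s' ltss E]] := root_sign (simple_word_root s Rj); last first.
  by exists (i :: s') => //=; rewrite -comp_lfunA E.
exists s => //; have [ji|ji] := eqVneq (simple_word s (al j)) (al i).
  rewrite -comp_lfunA reflection_word_conj ji comp_lfunA reflectionK //.
  by rewrite comp_lfun1l.
have := simple_reflection_positive pb ji.
by rewrite linearN in neg => /positive_root_opp/(_ neg).
Qed.

End Roots.

(** * Intertwiners in the affine Hecke algebra *)

Section Intertwiners.
Set Implicit Arguments.
Unset Strict Implicit.
Variables (R : realType) (V : vectType R) (n : nat) (D : rootDatum V n).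
Variable q : R[i].
Hypothesis q_neq0 : q != 0.
Local Notation H := (hecke D q).
Local Notation X l := (heckeX q l).
Local Notation T i := (heckeT D q i).
Local Notation s_ i := (weyl_act (simple_reflection D i)).
Local Notation al i := (simple_weight D i).
Local Notation c := (q - q^-1).
Implicit Types (l m : weight D) (i : 'I_n) (g h : H) (a b : R[i]).

Lemma heckeXC l m : X l * X m = X m * X l.
Proof. by rewrite -!heckeXD addrC. Qed.

Lemma heckeX_sumX l r :
  GRing.comm (X l) (acls (hecke_rel q) (sumX r) : H).
Proof.
elim: r => [|m r IH]; first exact: commr0.
by rewrite /= aclsD; apply: commrD => //; exact: heckeXC.
Qed.

Lemma heckeX_demazure l i m :
  GRing.comm (X l) (acls (hecke_rel q) (demazure_quotient i m) : H).
Proof.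
rewrite /demazure_quotient; case: Num.floor => k; first exact: heckeX_sumX.
by rewrite aclsN; apply: commrN; exact: heckeX_sumX.
Qed.

Lemma heckeXT l i :
  X l * T i = T i * X (s_ i l)
    + c *: (acls (hecke_rel q) (demazure_quotient i l) : H).
Proof.
by rewrite -aclsZ -!aclsM -aclsD; apply/aclsP/acong_rel/hecke_XT.
Qed.

Lemma heckeTT i : T i * T i = c *: T i + 1.
Proof.
rewrite -aclsZ -aclsM -[1]/(acls _ (AConst 1)) -aclsD.
exact/aclsP/acong_rel/hecke_quadratic.
Qed.

(** The usual intertwiner [T_i - c / (1 - X^(-alpha_i))], multiplied on the right by its denominator
    so that it lies in the algebra. *)
Definition intertwiner i : H := T i * (1 - X (- al i)) - c *: (1 : H).

(** The factor [1 - X^(-alpha_i)] clears the denominator in the relation for [X^l T_i]; of the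
    resulting [c (X^l - X^(s_i l))], the first term cancels against [- c X^l]. *)
Lemma heckeX_intertwiner l i :
  X l * intertwiner i = intertwiner i * X (s_ i l).
Proof.
have XC m m' : (1 - X m) * X m' = X m' * (1 - X m).
  by rewrite mulrBl mulrBr mul1r mulr1 heckeXC.
rewrite /intertwiner mulrBr mulrBl mulrA heckeXT mulrDl -!mulrA -XC.
rewrite -presented_scaleAl -presented_scaleAr mulr1.
rewrite -[in RHS]presented_scaleAl mul1r -addrA; congr (_ + _).
have -> (d : H) : GRing.comm (X (- al i)) d ->
    d * (1 - X (- al i)) = (1 - X (- al i)) * d.
- by move=> E; rewrite mulrBr mulrBl mulr1 mul1r E.
- by rewrite demazure_quotientP scalerBr addrAC subrr add0r.
- exact: heckeX_demazure.
Qed.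

Lemma weight_valN l : weight_val (- l) = - weight_val l.
Proof. exact: (raddfN (\val : weight D -> V)). Qed.

Lemma simple_reflection_simple i : s_ i (- al i) = al i.
Proof.
have E : weight_val (- al i) = - tnth (simple D) i by exact: weight_valN.
apply: val_inj; rewrite /= comp_lfun1l [U in reflection _ _ U]E linearN /=.
by rewrite reflection_self ?opprK // simple_root.
Qed.

Lemma heckeXNX i : X (- al i) * X (al i) = 1.
Proof. by rewrite -heckeXD addNr heckeX0. Qed.

(** With [Y = X^(-alpha_i)] and [Z = X^(alpha_i)], moving the second factor past [1 - Y] turns the
    latter into [1 - Z], and the quadratic relation removes [T_i^2]. *)
Lemma intertwiner_sqr i : intertwiner i * intertwiner i =
  (q ^+ 2 + q ^- 2) *: (1 : H) - X (- al i) - X (al i).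
Proof.
set Y := X (- al i); set Z := X (al i).
have Yphi : (1 - Y) * intertwiner i = intertwiner i * (1 - Z).
  rewrite mulrBl [in RHS]mulrBr mul1r mulr1 heckeX_intertwiner.
  by rewrite simple_reflection_simple.
have YZ : Y * (1 - Z) = Y - 1 by rewrite mulrBr mulr1 heckeXNX.
have Tphi : T i * intertwiner i = (1 - Y) - c *: (T i * Y).
  rewrite /intertwiner mulrBr mulrA heckeTT mulrDl mul1r -/Y.
  rewrite -presented_scaleAl -presented_scaleAr mulr1 mulrBr mulr1 scalerBr.
  by rewrite addrAC [_ - _ - _]addrAC subrr sub0r addrC.
rewrite {1}/intertwiner -/Y mulrBl -mulrA Yphi mulrA Tphi mulrBl.
rewrite -!presented_scaleAl mul1r -mulrA YZ.
rewrite /intertwiner -/Y scalerBr scalerA.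
rewrite -[Y - 1]opprB mulrN scalerN opprK.
(* The two terms in [T_i] cancel, which leaves [(1 - Y)(1 - Z) + c^2]. *)
rewrite opprB addrA addrAC addrK.
rewrite mulrBl mul1r YZ opprB.
have -> : c * c = q ^+ 2 + q ^- 2 - 1 - 1.
  by field.
rewrite !scalerBl scale1r.
by rewrite addrC !addrA subrK [_ - Z + 1]addrAC subrK addrAC.
Qed.

Lemma heckeX_intertwiner_exp l i a k :
  (X l - a *: (1 : H)) ^+ k * intertwiner i =
  intertwiner i * (X (s_ i l) - a *: (1 : H)) ^+ k.
Proof.
elim: k => [|k IH]; first by rewrite !expr0 mul1r mulr1.
have E : (X l - a *: (1 : H)) * intertwiner i =
    intertwiner i * (X (s_ i l) - a *: (1 : H)).
  rewrite mulrBl [RHS]mulrBr heckeX_intertwiner.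
  by rewrite -presented_scaleAl -presented_scaleAr mul1r mulr1.
by rewrite exprSr -mulrA E mulrA IH -mulrA -exprSr.
Qed.

(** * Action of the intertwiners on generalized weight spaces *)

Variables (M : vectType R[i]) (rho : heckeModule D q M).
Implicit Types (t : torus D) (u v : M).

Lemma gen_weight_intertwiner t t' i u :
  (forall l, t' l = t (s_ i l)) ->
  gen_weight_vector rho t u -> gen_weight_vector rho t' (rho (intertwiner i) u).
Proof.
move=> tt' gu l; have [k [k0 uk]] := gu (s_ i l).
exists k; split=> //; rewrite -comp_lfunE -hactM heckeX_intertwiner_exp hactM.
by rewrite comp_lfunE tt' uk linear0.
Qed.

Lemma hactB g h u : rho (g - h) u = rho g u - rho h u.
Proof.
have -> : g - h = (-1) *: h + g by rewrite scaleN1r addrC.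
by rewrite hact_linear add_lfunE scale_lfunE scaleN1r addrC.
Qed.

Lemma hactZ1 a u : rho (a *: (1 : H)) u = a *: u.
Proof.
(* Zero is written as [1 - 1] so that [hact_linear] applies and [hactB] evaluates the second
   summand. *)
have -> : a *: (1 : H) = a *: (1 : H) + (1 - 1) by rewrite subrr addr0.
rewrite hact_linear add_lfunE scale_lfunE hactB hact1.
by rewrite subrr addr0 id_lfunE.
Qed.

(** If [X^l] acts on [u] by [a], then [(X^l - t(X^l))^k] acts on it by the nonzero scalar
    [(a - t(X^l))^k], and some such power kills [u]. *)
Lemma gen_weight_eigen0 t l a u : a != t l ->
  gen_weight_vector rho t u -> rho (X l - a *: (1 : H)) u = 0 -> u = 0.
Proof.
move=> at_ gu; have [k [_ uk]] := gu l; rewrite hactB hactZ1 => /eqP.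
rewrite subr_eq0 => /eqP Xu; apply/eqP; move: uk.
have -> : rho ((X l - t l *: (1 : H)) ^+ k) u = (a - t l) ^+ k *: u.
  elim: k => [|k IH]; first by rewrite !expr0 hact1 id_lfunE scale1r.
  rewrite exprSr hactM comp_lfunE hactB hactZ1 Xu -scalerBl linearZ /= IH.
  by rewrite scalerA -exprS.
by move/eqP; rewrite scaler_eq0 expf_eq0 subr_eq0 (negPf at_) andbF.
Qed.

Lemma gen_weightX t l a u : gen_weight_vector rho t u ->
  gen_weight_vector rho t (rho (X l - a *: (1 : H)) u).
Proof.
move=> gu m; have [k [k0 uk]] := gu m; exists k; split=> //.
have XC : GRing.comm (X m - t m *: (1 : H)) (X l - a *: (1 : H)).
  have commZ1 (b : R[i]) g : GRing.comm g (b *: (1 : H)).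
    by rewrite /GRing.comm -presented_scaleAl -presented_scaleAr mul1r mulr1.
  apply: commrB => //; apply: commr_sym; apply: commrB => //.
  exact: heckeXC.
by rewrite -comp_lfunE -hactM -(commrX k (commr_sym XC)) hactM comp_lfunE uk linear0.
Qed.

Lemma intertwiner_injective t i u :
  t (al i) != q ^+ 2 -> t (al i) != q ^- 2 ->
  gen_weight_vector rho t u -> rho (intertwiner i) u = 0 -> u = 0.
Proof.
move=> t1 t2 gu phiu.
have E : (X (al i) - q ^+ 2 *: (1 : H)) * (X (al i) - q ^- 2 *: (1 : H)) =
  0 - X (al i) * (intertwiner i * intertwiner i).
  apply: oppr_inj; rewrite sub0r opprK; apply: esym.
  rewrite intertwiner_sqr !mulrBr -presented_scaleAr mulr1.
  have -> : X (al i) * X (- al i) = 1 by rewrite heckeXC heckeXNX.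
  rewrite !mulrBl -!presented_scaleAl -!presented_scaleAr !mul1r mulr1.
  rewrite scalerA divff ?expf_neq0 // scale1r scalerDl.
  rewrite !opprB addrA; congr (_ - _).
  by rewrite [RHS]addrAC; congr (_ - _); rewrite addrC.
(* The two factors are stripped one at a time: [X^(alpha_i) - q^-2] maps [u] to a vector of the same
   generalized weight space, to which the argument for [q^2] applies first. *)
apply: (@gen_weight_eigen0 t (al i) (q ^- 2)) => //; first by rewrite eq_sym.
apply: (@gen_weight_eigen0 t (al i) (q ^+ 2)); first by rewrite eq_sym.
  exact: gen_weightX.
rewrite -comp_lfunE -hactM E hactB !hactM !comp_lfunE phiu !linear0.
by rewrite addr0 -(subrr (1 : H)) hactB subrr.
Qed.

Lemma torusN t l : t (- l) = (t l)^-1.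
Proof.
have t0 : t 0 = 1.
  by apply: (mulfI (torus_neq0 t 0)); rewrite -torusD addr0 mulr1.
by apply: (mulfI (torus_neq0 t l)); rewrite -torusD subrr divff ?torus_neq0.
Qed.

Lemma gen_weight_dim_le t t' i :
  t (al i) != q ^+ 2 -> t (al i) != q ^- 2 -> (forall l, t' l = t (s_ i l)) ->
  (\dim (gen_weight_space rho t) <= \dim (gen_weight_space rho t'))%N.
Proof.
move=> t1 t2 tt'; rewrite -(@limg_dim_eq _ _ _ (rho (intertwiner i))).
  apply: dimvS; apply/subvP => _ /memv_imgP[u /mem_gen_weight_space gu ->].
  by apply/mem_gen_weight_space; exact: gen_weight_intertwiner gu.
apply/eqP; rewrite -subv0; apply/subvP => u; rewrite memv_cap memv_ker.
move=> /andP[/mem_gen_weight_space gu /eqP phiu].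
by rewrite memv0; apply/eqP; exact: intertwiner_injective t1 t2 gu phiu.
Qed.

(** The hypotheses are symmetric in [t] and [t']: [s_i] is an involution and [t'(X^(alpha_i))] is
    the inverse of [t(X^(alpha_i))], so it also avoids [q^2] and [q^-2]. *)
Lemma gen_weight_dim_eq t t' i :
  t (al i) != q ^+ 2 -> t (al i) != q ^- 2 -> (forall l, t' l = t (s_ i l)) ->
  \dim (gen_weight_space rho t) = \dim (gen_weight_space rho t').
Proof.
move=> t1 t2 tt'.
have t'V : t' (al i) = (t (al i))^-1.
  by rewrite -[LHS]invrK -torusN tt' simple_reflection_simple.
have t't l : t l = t' (s_ i l).
  rewrite tt'; congr (t _); apply: val_inj => /=.
  by rewrite !comp_lfun1l reflectK // simple_root.
apply/eqP; rewrite eqn_leq !(@gen_weight_dim_le _ _ i) // t'V.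
  by rewrite -(inj_eq invr_inj) invrK.
by rewrite (inj_eq invr_inj).
Qed.

End Intertwiners.

(** * Inversion sets and crossing walls inside [F^(t,J)] *)

Section Connectedness.
Set Implicit Arguments.
Unset Strict Implicit.
Variables (R : realType) (V : vectType R) (n : nat) (D : rootDatum V n).
Variable q : R[i].
Hypothesis q_neq0 : q != 0.
Variables (M : vectType R[i]) (rho : heckeModule D q M).
Variables (t : torus D) (J : set (weight D)).
Local Notation al i := (tnth (simple D) i).
Local Notation refl a := (reflection (form D) a).
Implicit Types (w : weyl D) (i : 'I_n).

Definition simple_mul i w : weyl D :=
  Weyl (in_weylM (simple_root D i) (weylP w)).

(** [weyl_inv] uses the inverse of endomorphisms, here identified with the two-sided inverse [u]
    found in the Weyl group. *)
Lemma weyl_act_inv w l : weyl_act w (weyl_act (weyl_inv w) l) = l.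
Proof.
have [u _ [uw wu]] := in_weyl_inverse (weylP w).
apply: val_inj => /=; rewrite -comp_lfunE.
have kw : lker (weyl_val w) == 0%VS.
  apply/lker0P => x y xy.
  by rewrite -[x](id_lfunE x) -[y](id_lfunE y) -uw !comp_lfunE xy.
suff -> : ((weyl_val w)^-1)%VF = u by rewrite wu id_lfunE.
by rewrite -[u]comp_lfun1l -(lker0_compVf kw) -comp_lfunA wu comp_lfun1r.
Qed.

Lemma weyl_act_inj w : injective (weyl_act w).
Proof.
have [u _ [uw _]] := in_weyl_inverse (weylP w).
move=> l m /(congr1 (fun x => u (weight_val x))) /=.
by rewrite -!comp_lfunE uw !id_lfunE => /val_inj.
Qed.

Lemma weyl_act_simple_mul i w l :
  weyl_act (simple_mul i w) l =
  weyl_act (simple_reflection D i) (weyl_act w l).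
Proof. by apply: val_inj; rewrite /= comp_lfun1l comp_lfunE. Qed.

Lemma torus_act_simple_mul i w l :
  torus_act (simple_mul i w) t l =
  torus_act w t (weyl_act (simple_reflection D i) l).
Proof.
rewrite /torus_act /=; congr (t _).
apply: (@weyl_act_inj (simple_mul i w)).
rewrite weyl_act_inv weyl_act_simple_mul weyl_act_inv.
by apply: val_inj; rewrite /= !comp_lfun1l reflectK // simple_root.
Qed.

Lemma weyl_actN w l : weyl_act w (- l) = - weyl_act w l.
Proof.
apply: val_inj; apply: etrans (esym (weight_valN _)).
by apply: etrans (linearN _ _); congr (weyl_val w _); exact: weight_valN.
Qed.

Lemma RnegE (l : weight D) : Rneg l = positive_root D (- weight_val l).
Proof. by rewrite -weight_valN. Qed.

Lemma Rpos_opp (l : weight D) : Rpos l -> Rneg l -> False.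
Proof. by rewrite RnegE; exact: positive_root_opp. Qed.

Lemma Rpos_simple i : Rpos (simple_weight D i).
Proof. exact: simple_positive. Qed.

Lemma Rpos_simple_reflection i l : Rpos l -> l <> simple_weight D i ->
  Rpos (weyl_act (simple_reflection D i) l).
Proof.
move=> pl li; rewrite /Rpos /= comp_lfun1l.
apply: simple_reflection_positive => //; apply/eqP => E.
by apply: li; exact: val_inj.
Qed.

Lemma weyl_act_sign w l : Rpos l -> Rpos (weyl_act w l) \/ Rneg (weyl_act w l).
Proof.
move=> [Rl _]; rewrite RnegE.
exact: root_sign (in_weyl_root (weylP w) Rl).
Qed.

(** Among the roots, [s_i] changes the sign of [alpha_i] and [- alpha_i] only. *)
Lemma inversions_simple_mul i w l :
  Rpos l -> weyl_act w l <> simple_weight D i ->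
  weyl_act w l <> - simple_weight D i ->
  inversions (simple_mul i w) l <-> inversions w l.
Proof.
move=> pl li lNi; rewrite /inversions /= weyl_act_simple_mul.
split=> -[_ neg]; split=> //.
  have [pos|//] := weyl_act_sign w pl.
  by have /Rpos_opp/(_ neg) := Rpos_simple_reflection pos li.
rewrite /Rneg /mkset -weyl_actN; apply: Rpos_simple_reflection => // E.
by apply: lNi; rewrite -E opprK.
Qed.

(** Elements of [F^(t,J)] invert no root of [Z(t)] and the same roots of [P(t)], namely [J]; a root
    inverted by just one of them is in neither set. *)
Lemma Fset_separated w w' l : Fset q t J w -> Fset q t J w' ->
  inversions w l -> ~ inversions w' l -> ~ Zset t l /\ ~ Pset q t l.
Proof.
move=> [Zw Pw] [_ Pw'] lw lw'; split=> [Zl|Pl].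
  by have : (inversions w `&` Zset t) l by []; rewrite Zw.
by have : (inversions w `&` Pset q t) l by []; rewrite Pw -Pw' => -[].
Qed.

(* [l] is the positive root of the wall between [w] and [s_i w], which also
   separates [w] from [w']. *)
Lemma Fset_wall i w w' l : Fset q t J w -> Fset q t J w' ->
  Rneg (weyl_act w' (weyl_act (weyl_inv w) (simple_weight D i))) ->
  Rpos l ->
  weyl_act w l = simple_weight D i \/ weyl_act w l = - simple_weight D i ->
  ~ Zset t l /\ ~ Pset q t l.
Proof.
set b := weyl_act (weyl_inv w) _ => Fw Fw' neg pl.
case=> E.
  have {E}lb : l = b by apply: (@weyl_act_inj w); rewrite weyl_act_inv.
  apply: (Fset_separated Fw' Fw); first by rewrite lb in pl *.
  by case=> _; rewrite lb weyl_act_inv; apply: Rpos_opp; exact: Rpos_simple.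
have {E}lb : l = - b.
  by apply: (@weyl_act_inj w); rewrite weyl_actN weyl_act_inv.
apply: (Fset_separated Fw Fw').
  split=> //; rewrite lb weyl_actN weyl_act_inv /Rneg /= opprK.
  exact: Rpos_simple.
by case=> _; apply: Rpos_opp; rewrite lb weyl_actN.
Qed.

(** The inversions of [w] and [s_i w] differ only in the wall root, which [Fset_wall] puts outside
    [Z(t)] and [P(t)]. *)
Lemma Fset_simple_mul i w w' : Fset q t J w -> Fset q t J w' ->
  Rneg (weyl_act w' (weyl_act (weyl_inv w) (simple_weight D i))) ->
  Fset q t J (simple_mul i w).
Proof.
move=> Fw Fw' neg.
have E (S : set (weight D)) : S `<=` @Rpos _ _ _ D ->
    (forall l, S l -> Zset t l \/ Pset q t l) ->
    inversions (simple_mul i w) `&` S = inversions w `&` S.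
  move=> Spos SZP.
  have H l : S l -> inversions (simple_mul i w) l <-> inversions w l.
    move=> Sl; apply: inversions_simple_mul; first exact: Spos.
      by move=> lE; have [] := Fset_wall Fw Fw' neg (Spos _ Sl) (or_introl lE);
        case: (SZP _ Sl).
    by move=> lE; have [] := Fset_wall Fw Fw' neg (Spos _ Sl) (or_intror lE);
      case: (SZP _ Sl).
  by rewrite eqEsubset; split=> l [Hl Sl]; split=> //; apply/(H l Sl).
have [Zw Pw] := Fw; split.
  by rewrite E // => [l []|l]; [|left].
by rewrite E // => [l []|l]; [|right].
Qed.

(** The value in question is [t] at [w^-1 alpha_i], the wall root up to sign; a change of sign swaps
    [q^2] and [q^-2]. *)
Lemma Fset_not_pole i w w' : Fset q t J w -> Fset q t J w' ->
  Rneg (weyl_act w' (weyl_act (weyl_inv w) (simple_weight D i))) ->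
  torus_act w t (simple_weight D i) != q ^+ 2 /\
  torus_act w t (simple_weight D i) != q ^- 2.
Proof.
move=> Fw Fw' neg; rewrite /torus_act /=.
have [pb|pb] := weyl_act_sign (weyl_inv w) (Rpos_simple i).
  have [|_ nP] := Fset_wall Fw Fw' neg pb; first by left; exact: weyl_act_inv.
  by split; apply/eqP => E; apply: nP; split=> //; [left|right].
have [|_ nP] := Fset_wall Fw Fw' neg pb.
  by right; rewrite weyl_actN weyl_act_inv.
split; apply/eqP => E; apply: nP; split=> //; rewrite torusN E.
  by right.
by left; rewrite invrK.
Qed.

Lemma Fset_dim_word s w w' : Fset q t J w -> Fset q t J w' ->
  weyl_val w' = (simple_word D s \o weyl_val w)%VF ->
  \dim (gen_weight_space rho (torus_act w t)) =
  \dim (gen_weight_space rho (torus_act w' t)).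
Proof.
have [N] := ubnP (size s); elim: N s w => // N IH s w ltN Fw Fw'.
case/lastP: s ltN => [_ E|s i ltN E].
  rewrite /= comp_lfun1l in E.
  suff -> : w = w' by [].
  move: w w' E {IH Fw Fw'} => [u Wu] [u' Wu'] /= E; subst u'.
  by congr Weyl; exact: Prop_irrelevance.
(* Since [s_i] negates [al i], the sign of [simple_word D s (al i)] decides between crossing the
   wall and deleting letters. *)
have Ei : weight_val (weyl_act w' (weyl_act (weyl_inv w) (simple_weight D i))) =
    - simple_word D s (al i).
  rewrite /= E simple_word_rcons -comp_lfunA !comp_lfunE.
  have /(congr1 (@weight_val _ _ _ _)) /= -> := weyl_act_inv w (simple_weight D i).
  by rewrite reflection_self ?linearN // simple_root.
have Rs : simple_word D s (al i) \in Defs.roots D.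
  exact: simple_word_root (simple_root D i).
have [pos|neg] := root_sign Rs.
  have negw : Rneg (weyl_act w' (weyl_act (weyl_inv w) (simple_weight D i))).
    by rewrite RnegE Ei opprK.
  have [t1 t2] := Fset_not_pole Fw Fw' negw.
  rewrite (gen_weight_dim_eq q_neq0 rho t1 t2 (torus_act_simple_mul i w)).
  apply: (IH s) => //; first by rewrite size_rcons ltnS in ltN.
    exact: Fset_simple_mul Fw Fw' negw.
  by rewrite E simple_word_rcons comp_lfunA.
(* Here [w] stays fixed; only the word for [w' w^-1] is shortened. *)
have [s' lts sE] := simple_word_deletion neg.
apply: (IH s') => //; first by rewrite size_rcons ltnS in ltN; exact: ltn_trans ltN.
by rewrite E simple_word_rcons sE.
Qed.

End Connectedness.

Theorem corollary2p19 (R : realType) (V : vectType R) (n : nat)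
    (D : rootDatum V n) (q : R[i])
    (q_neq0 : q != 0) (q2_neq1 : q ^+ 2 != 1) (q2_neqN1 : q ^+ 2 != -1)
    (M : vectType R[i]) (rho : heckeModule D q M)
    (t : torus D) (J : set (weight D)) (JP : J `<=` Pset q t) :
  forall w w' : weyl D, Fset q t J w -> Fset q t J w' ->
    \dim (gen_weight_space rho (torus_act w t)) =
    \dim (gen_weight_space rho (torus_act w' t)).
Proof.
move=> w w' Fw Fw'.
have [u Wu [uw wu]] := in_weyl_inverse (weylP w).
(* [u] is the inverse of [w], so [s] is a word for [w' w^-1]. *)
have [s sE] : exists s, (weyl_val w' \o u)%VF = simple_word D s.
  apply: weyl_word; elim: (weylP w') => [|a v Ra _ IH].
    by rewrite comp_lfun1l.
  by rewrite -comp_lfunA; exact: in_weylM.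
apply: (Fset_dim_word q_neq0 rho Fw Fw' (s := s)).
by rewrite -sE -comp_lfunA uw comp_lfun1r.
Qed.
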